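(* Let $H$ and $K$ be Hopf algebras with an algebra action $\rightharpoonup:H\to\mathrm{End}(K)$ such that $K$ is an $H$-module bialgebra. A coalgebra homomorphism $\pi:H\to K$ is a Hopf algebra crossed homomorphism with respect to the action $\rightharpoonup$ if and only if its graph $$\mathrm{Gr}_\pi=\{\pi(a_1)\otimes a_2 \mid a\in H\}\subseteq K\otimes H$$ is a subalgebra of the smash product algebra $K\# H$.
   Context: Everything is over a field $\mathbf{k}$ of characteristic $0$. Sweedler notation: $\Delta(a)=a_1\otimes a_2$. Subalgebras are unital. $K$ is an $H$-module algebra via an algebra action $\rightharpoonup$ if $a\rightharpoonup 1=\varepsilon(a)1$ and $a\rightharpoonup(xy)=(a_1\rightharpoonup x)(a_2\rightharpoonup y)$; it is an $H$-module bialgebra if moreover $\varepsilon_K(a\rightharpoonup x)=\varepsilon_H(a)\varepsilon_K(x)$ and $\Delta_K(a\rightharpoonup x)=(a_1\rightharpoonup x_1)\otimes(a_2\rightharpoonup x_2)$, for all $a\in H$, $x,y\in K$. A Hopf algebra crossed homomorphism $\pi:H\to K$ with respect to $\rightharpoonup$ is a coalgebra homomorphism with $\pi(ab)=\pi(a_1)(a_2\rightharpoonup\pi(b))$ for all $a,b\in H$. The smash product algebra $K\# H$ is $K\otimes H$ (with $x\otimes a$ written $x\# a$) with unit $1\#1$ and multiplication $(x\# a)(y\# b)=x(a_1\rightharpoonup y)\# a_2b$. The graph $\mathrm{Gr}_\pi$ is the image of $(\pi\otimes\mathrm{id})\Delta_H:H\to K\otimes H$. *)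

(* Defs.v *)
From HB Require Import structures.
From mathcomp Require Import all_boot all_order all_algebra.
From mathcomp Require Import boolp classical_sets.

Set Implicit Arguments.
Unset Strict Implicit.
Unset Printing Implicit Defensive.

Import GRing.Theory.

Local Open Scope quotient_scope.
Local Open Scope ring_scope.

Reserved Notation "x ⊗ y" (at level 40, left associativity).
Reserved Notation "\sw_ ( a1 , a2 <- a ) F"
  (at level 34, F at level 34, a1 name, a2 name, a at level 60,
   format "'[' \sw_ ( a1 ,  a2  <-  a ) '/  '  F ']'").

Notation bilin f := (bilinear_for *:%R *:%R f).

Section Linear.
Context {k : fieldType}.
Variables U W : lmodType k.
Variable f : U -> W.
Hypothesis lf : linear f.

Lemma lin0 : f 0 = 0.
Proof.
by have := lf 1 0 0; rewrite !scale1r addr0 -{1}[f 0]addr0 => /addrI.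
Qed.

Lemma linD x y : f (x + y) = f x + f y.
Proof. by rewrite -{1}[x]scale1r lf scale1r. Qed.

Lemma linZ c x : f (c *: x) = c *: f x.
Proof. by rewrite -[c *: x]addr0 lf lin0 addr0. Qed.

Lemma lin_sum I (r : seq I) (F : I -> U) :
  f (\sum_(i <- r) F i) = \sum_(i <- r) f (F i).
Proof.
by elim: r => [|i r IHr]; rewrite ?(big_nil, big_cons) ?lin0 // linD IHr.
Qed.

End Linear.

Section Tensor.
Context {k : fieldType}.
Variables U V : lmodType k.

(* A list [:: (u1, v1); ...; (un, vn)] stands for u1 ⊗ v1 + ... + un ⊗ vn. *)
Inductive tensor_cong : seq (U * V) -> seq (U * V) -> Prop :=
| TCrefl s : tensor_cong s s
| TCsym s t : tensor_cong s t -> tensor_cong t s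
| TCtrans s t r : tensor_cong s t -> tensor_cong t r -> tensor_cong s r
| TCcat s s' t t' :
    tensor_cong s s' -> tensor_cong t t' -> tensor_cong (s ++ t) (s' ++ t')
| TCcatC s t : tensor_cong (s ++ t) (t ++ s)
| TC0 v : tensor_cong [:: (0, v)] [::]
| TCDl u u' v : tensor_cong [:: (u + u', v)] [:: (u, v); (u', v)]
| TCDr u v v' : tensor_cong [:: (u, v + v')] [:: (u, v); (u, v')]
| TCZ c u v : tensor_cong [:: (c *: u, v)] [:: (u, c *: v)].

Definition tensor_rel : rel (seq (U * V)) := fun s t => `[< tensor_cong s t >].

Lemma tensor_rel_refl : reflexive tensor_rel.
Proof. by move=> s; apply/asboolP; exact: TCrefl. Qed.

Lemma tensor_rel_sym : symmetric tensor_rel.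
Proof. by move=> s t; apply/asboolP/asboolP; exact: TCsym. Qed.

Lemma tensor_rel_trans : transitive tensor_rel.
Proof.
by move=> t s r /asboolP st /asboolP tr; apply/asboolP; exact: TCtrans tr.
Qed.

Canonical tensor_equiv :=
  EquivRel tensor_rel tensor_rel_refl tensor_rel_sym tensor_rel_trans.

Definition tensor := {eq_quot tensor_equiv}.

HB.instance Definition _ := Choice.on tensor.

Definition tpi (s : seq (U * V)) : tensor := \pi_tensor s.

Definition trepr (t : tensor) : seq (U * V) := repr t.

Definition tpure (u : U) (v : V) : tensor := tpi [:: (u, v)].

Lemma treprK t : tpi (trepr t) = t.
Proof. exact: reprK. Qed.

Lemma tpiP s t : tpi s = tpi t <-> tensor_cong s t.
Proof. by split=> [/eqquotP/asboolP | /asboolP st]; last exact/eqquotP. Qed.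

Lemma trepr_tpi s : tensor_cong (trepr (tpi s)) s.
Proof. by apply/tpiP; rewrite treprK. Qed.

Definition tmapl (f : U -> U) (s : seq (U * V)) := [seq (f p.1, p.2) | p <- s].

Lemma tmapl_scale_cong c s t :
  tensor_cong s t -> tensor_cong (tmapl ( *:%R c) s) (tmapl ( *:%R c) t).
Proof.
elim=> {s t} [s|s t _|s t r _ + _|s s' t t' _ + _|s t|v|u u' v|u v v'|d u v];
  rewrite /tmapl ?map_cat /=.
- exact: TCrefl.
- exact: TCsym.
- exact: TCtrans.
- exact: TCcat.
- exact: TCcatC.
- by rewrite scaler0; exact: TC0.
- by rewrite scalerDr; exact: TCDl.
- exact: TCDr.
- by rewrite scalerA mulrC -scalerA; exact: TCZ.
Qed.

Definition tensor_zero : tensor := tpi [::].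
Definition tensor_add (s t : tensor) : tensor := tpi (trepr s ++ trepr t).
Definition tensor_scale c (t : tensor) : tensor := tpi (tmapl ( *:%R c) (trepr t)).
Definition tensor_opp (t : tensor) : tensor := tensor_scale (-1) t.

Lemma tpi_cat s t : tensor_add (tpi s) (tpi t) = tpi (s ++ t).
Proof. by apply/tpiP; apply: TCcat; exact: trepr_tpi. Qed.

Lemma tpi_scale c s : tensor_scale c (tpi s) = tpi (tmapl ( *:%R c) s).
Proof. by apply/tpiP; apply: tmapl_scale_cong; exact: trepr_tpi. Qed.

Lemma tensor_addA : associative tensor_add.
Proof.
move=> x y z; rewrite -(treprK x) -(treprK y) -(treprK z).
by rewrite !tpi_cat catA.
Qed.

Lemma tensor_addC : commutative tensor_add.
Proof. by move=> x y; apply/tpiP; exact: TCcatC. Qed.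

Lemma tensor_add0 : left_id tensor_zero tensor_add.
Proof. by move=> x; rewrite -(treprK x) tpi_cat. Qed.

Lemma tensor_scaleDl t :
  {morph tensor_scale^~ t : a b / a + b >-> tensor_add a b}.
Proof.
move=> a b; rewrite -(treprK t) !tpi_scale tpi_cat; apply/tpiP.
elim: (trepr t) => [|[u v] s IHs] /=; first exact: TCrefl.
rewrite scalerDl; apply: (TCtrans (@TCcat [:: _] _ _ _ (TCDl _ _ _) IHs)).
apply: (@TCcat [:: _] [:: _] _ _ (TCrefl _)).
set s1 := tmapl _ s; set s2 := tmapl _ s.
rewrite -[X in tensor_cong X _]/(([:: (b *: u, v)] ++ s1) ++ s2).
rewrite -[(b *: u, v) :: s2]/([:: (b *: u, v)] ++ s2) catA.
exact: TCcat (TCcatC _ _) (TCrefl _).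
Qed.

Lemma tensor_scale0 t : tensor_scale 0 t = tensor_zero.
Proof.
rewrite -(treprK t) tpi_scale; apply/tpiP.
elim: (trepr t) => [|[u v] s IHs] /=; first exact: TCrefl.
by rewrite scale0r; exact: (@TCcat [:: _] [::] _ [::] (TC0 _) IHs).
Qed.

Lemma tensor_scale1 : left_id 1 tensor_scale.
Proof.
move=> t; rewrite -(treprK t) tpi_scale; congr tpi.
by rewrite /tmapl -[RHS]map_id; apply: eq_map => -[u v] /=; rewrite scale1r.
Qed.

Lemma tensor_addN : left_inverse tensor_zero tensor_opp tensor_add.
Proof.
by move=> t; rewrite -{2}[t]tensor_scale1 -tensor_scaleDl addNr tensor_scale0.
Qed.

HB.instance Definition _ := GRing.isZmodule.Build tensor
  tensor_addA tensor_addC tensor_add0 tensor_addN.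

Lemma tensor_scaleA a b t :
  tensor_scale a (tensor_scale b t) = tensor_scale (a * b) t.
Proof.
rewrite -(treprK t) !tpi_scale; congr tpi; rewrite /tmapl -map_comp.
by apply: eq_map => -[u v] /=; rewrite scalerA.
Qed.

Lemma tensor_scaleDr : right_distributive tensor_scale +%R.
Proof.
move=> a s t; rewrite -(treprK s) -(treprK t).
transitivity (tensor_scale a (tpi (trepr s ++ trepr t))).
  by congr tensor_scale; exact: tpi_cat.
rewrite !tpi_scale /tmapl map_cat; exact/esym/tpi_cat.
Qed.

HB.instance Definition _ := GRing.Zmodule_isLmodule.Build k tensor
  tensor_scaleA tensor_scale1 tensor_scaleDr tensor_scaleDl.

Lemma tpiD s t : tpi s + tpi t = tpi (s ++ t).
Proof. exact: tpi_cat. Qed.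

Lemma tpiZ c s : c *: tpi s = tpi (tmapl ( *:%R c) s).
Proof. exact: tpi_scale. Qed.

Lemma tpure_bilinear : bilin tpure.
Proof.
split=> [v c u u' | u c v v'] /=; rewrite /tpure tpiZ tpiD; apply/tpiP.
  exact: TCDl.
apply: (TCtrans (TCDr _ _ _)).
exact: (@TCcat [:: _] [:: _] [:: _] _ (TCsym (TCZ _ _ _)) (TCrefl _)).
Qed.

Lemma tpiE s : tpi s = \sum_(p <- s) tpure p.1 p.2.
Proof.
elim: s => [|[u v] s IHs]; first by rewrite big_nil.
by rewrite big_cons -IHs tpiD.
Qed.

Lemma treprE t : t = \sum_(p <- trepr t) tpure p.1 p.2.
Proof. by rewrite -tpiE treprK. Qed.

(* For a bilinear f this is the linear map with u ⊗ v |-> f u v (tliftE,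
   tlift_linear); the value depends on the choice of trepr t otherwise. *)
Definition tlift (W : nmodType) (f : U -> V -> W) (t : tensor) : W :=
  \sum_(p <- trepr t) f p.1 p.2.

Lemma tlift_tpi (W : lmodType k) (f : U -> V -> W) s :
  bilin f -> tlift f (tpi s) = \sum_(p <- s) f p.1 p.2.
Proof.
move=> [fl fr]; rewrite /tlift.
have := trepr_tpi s; move: (trepr _) => t.
elim=> {s t} [//|s t _ -> //|s t r _ -> _ -> //|s s' t t' _ + _ +|s t|v|u u' v|u v v'|c u v].
- by rewrite !big_cat /= => -> ->.
- by rewrite !big_cat /= addrC.
- by rewrite big_seq1 big_nil (lin0 (fl v)).
- by rewrite !(big_cons, big_nil) /= !addr0 (linD (fl v)).
- by rewrite !(big_cons, big_nil) /= !addr0 (linD (fr u)).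
- by rewrite !big_seq1 /= (linZ (fl v)) (linZ (fr u)).
Qed.

Lemma tliftE (W : lmodType k) (f : U -> V -> W) u v :
  bilin f -> tlift f (tpure u v) = f u v.
Proof. by move=> /tlift_tpi->; rewrite big_seq1. Qed.

Lemma tlift_linear (W : lmodType k) (f : U -> V -> W) :
  bilin f -> linear (tlift f).
Proof.
move=> bf c s t.
have -> : c *: s + t = tpi (tmapl ( *:%R c) (trepr s) ++ trepr t).
  by rewrite -tpiD -tpiZ !treprK.
rewrite tlift_tpi // big_cat big_map /=; congr (_ + _).
rewrite /tlift scaler_sumr; apply: eq_bigr => p _ /=.
by rewrite (linZ (bf.1 p.2)).
Qed.

Lemma tensor_ind (P : tensor -> Prop) :
  P 0 -> (forall s t, P s -> P t -> P (s + t)) -> (forall u v, P (tpure u v)) ->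
  forall t, P t.
Proof.
move=> P0 PD Pp t; rewrite (treprE t).
by elim: (trepr t) => [|p s IHs]; rewrite ?big_nil // big_cons; exact: PD.
Qed.

Lemma tensor_ext (W : lmodType k) (f g : tensor -> W) :
  linear f -> linear g -> (forall u v, f (tpure u v) = g (tpure u v)) -> f =1 g.
Proof.
move=> lf lg fg t.
elim/tensor_ind: t => [|s t fs ft|//]; first by rewrite !lin0.
by rewrite (linD lf) (linD lg) fs ft.
Qed.

End Tensor.

Notation "U ⊗ V" := (tensor U%type V%type) : type_scope.
Notation "u ⊗ v" := (tpure u v) : ring_scope.

Section TensorMaps.
Context {k : fieldType}.

Definition tmap (U V U' V' : lmodType k) (f : U -> U') (g : V -> V') :
    U ⊗ V -> U' ⊗ V' :=
  tlift (fun u v => f u ⊗ g v).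

Definition tassoc (U V W : lmodType k) : (U ⊗ V) ⊗ W -> U ⊗ (V ⊗ W) :=
  tlift (fun t w => tlift (fun u v => u ⊗ (v ⊗ w)) t).

End TensorMaps.

(* Sealed copy of linear, so that the lemmas below can be found by syntactic
   matching. *)
Definition lin (k : fieldType) (U W : lmodType k) (f : U -> W) : Prop := linear f.

Section LinTheory.
Context {k : fieldType}.
Implicit Types U V W X : lmodType k.

Lemma bilinP U V W (f : U -> V -> W) :
  (forall v, lin (f^~ v)) -> (forall u, lin (f u)) -> bilin f.
Proof. by split. Qed.

Lemma bilin_linl U V W (f : U -> V -> W) X (g : X -> U) v :
  bilin f -> lin g -> lin (fun x => f (g x) v).
Proof. by move=> [fl _] lg c x y; rewrite lg; exact: fl. Qed.

Lemma bilin_linr U V W (f : U -> V -> W) X (g : X -> V) u :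
  bilin f -> lin g -> lin (fun x => f u (g x)).
Proof. by move=> [_ fr] lg c x y; rewrite lg; exact: fr. Qed.

Lemma lin_id U : lin (fun x : U => x).
Proof. by []. Qed.

Lemma lin_pure_l U V X (g : X -> U) (v : V) : lin g -> lin (fun x => g x ⊗ v).
Proof. exact: bilin_linl (tpure_bilinear U V). Qed.

Lemma lin_pure_r U V X (g : X -> V) (u : U) : lin g -> lin (fun x => u ⊗ g x).
Proof. exact: bilin_linr (tpure_bilinear U V). Qed.

Lemma lin_tlift_fun U V W X (f : X -> U -> V -> W) t :
  (forall u v, lin (fun x => f x u v)) -> lin (fun x => tlift (f x) t).
Proof.
move=> lf c x y; rewrite /tlift scaler_sumr -big_split /=.
by apply: eq_bigr => p _; rewrite lf.
Qed.

Lemma lin_tlift_arg U V W X (f : U -> V -> W) (g : X -> U ⊗ V) :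
  bilin f -> lin g -> lin (fun x => tlift f (g x)).
Proof. by move=> /tlift_linear lf lg c x y; rewrite lg lf. Qed.

Lemma lin_linear U W X (f : {linear U -> W}) (g : X -> U) :
  lin g -> lin (fun x => f (g x)).
Proof. by move=> lg c x y; rewrite lg linearP. Qed.

Lemma lin_scaler W X c (g : X -> W) : lin g -> lin (fun x => c *: g x).
Proof. by move=> lg d x y; rewrite lg scalerDr !scalerA mulrC. Qed.

Lemma lin_scalar U W X (f : {scalar U}) (g : X -> U) (w : W) :
  lin g -> lin (fun x => f (g x) *: w).
Proof. by move=> lg d x y; rewrite lg linearP scalerDl scalerA. Qed.

Lemma lin_mull (A : algType k) X (g : X -> A) (b : A) :
  lin g -> lin (fun x => g x * b).
Proof. by move=> lg d x y; rewrite lg mulrDl scalerAl. Qed.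

Lemma lin_mulr (A : algType k) X (g : X -> A) (b : A) :
  lin g -> lin (fun x => b * g x).
Proof. by move=> lg d x y; rewrite lg mulrDr scalerAr. Qed.

End LinTheory.

Ltac lin_step :=
  match goal with
  | |- forall _, _ => move=> ? /=
  | |- bilinear_for _ _ _ => apply: bilinP
  | |- lin (fun x => x) => exact: lin_id
  | |- lin (fun x => tpure _ _) => first [apply: lin_pure_l | apply: lin_pure_r]
  | |- lin (fun x => tlift _ _) =>
      first [apply: lin_tlift_arg | apply: lin_tlift_fun]
  | |- lin (fun x => _ * _) => first [apply: lin_mull | apply: lin_mulr]
  | |- lin (fun x => _ *: _) => first [apply: lin_scalar | apply: lin_scaler]
  | |- lin (fun x => _) => apply: lin_linear
  | |- lin ( *%R _) => apply: lin_mulr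
  | |- lin (tpure _) => apply: lin_pure_r
  | |- lin _ => exact: linearP
  end.
Ltac blin := do ! lin_step.

Lemma lin_tlift (k : fieldType) (U V W X : lmodType k) (f : U -> V -> W)
  (g : W -> X) t : lin g -> g (tlift f t) = tlift (fun u v => g (f u v)) t.
Proof. by move=> lg; rewrite (lin_sum lg). Qed.

Lemma eq_tlift (k : fieldType) (U V : lmodType k) (W : nmodType)
  (f g : U -> V -> W) t : f =2 g -> tlift f t = tlift g t.
Proof. by move=> fg; apply: eq_bigr => p _; exact: fg. Qed.

Lemma exchange_tlift (k : fieldType) (U V U' V' : lmodType k) (W : nmodType)
    (f : U -> V -> U' -> V' -> W) s t :
  tlift (fun u v => tlift (f u v) t) s =
  tlift (fun u' v' => tlift (fun u v => f u v u' v') s) t.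
Proof. exact: exchange_big. Qed.

Section TensorAlgebra.
Context {k : fieldType}.
Variables A B : algType k.

Definition tensor_mul (s t : A ⊗ B) : A ⊗ B :=
  tlift (fun a b => tlift (fun c d => (a * c) ⊗ (b * d)) t) s.

Lemma tensor_mul_bilinear : bilin tensor_mul.
Proof. rewrite /tensor_mul; blin. Qed.

Lemma tensor_mulE a b c d :
  tensor_mul (a ⊗ b) (c ⊗ d) = (a * c) ⊗ (b * d).
Proof. by rewrite /tensor_mul tliftE; [rewrite tliftE //; blin | blin]. Qed.

Lemma tensor_mulDl : left_distributive tensor_mul +%R.
Proof. by move=> x y z; rewrite (linD (tensor_mul_bilinear.1 z)). Qed.

Lemma tensor_mulDr : right_distributive tensor_mul +%R.
Proof. by move=> x y z; rewrite (linD (tensor_mul_bilinear.2 x)). Qed.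

Lemma tensor_mul0l : left_zero 0 tensor_mul.
Proof. by move=> x; rewrite (lin0 (tensor_mul_bilinear.1 x)). Qed.

Lemma tensor_mul0r : right_zero 0 tensor_mul.
Proof. by move=> x; rewrite (lin0 (tensor_mul_bilinear.2 x)). Qed.

Lemma tensor_mulA : associative tensor_mul.
Proof.
move=> x y z; elim/(@tensor_ind k A B): x => [|s t|a b]; rewrite ?tensor_mul0l //.
  by rewrite !tensor_mulDl => -> ->.
elim/(@tensor_ind k A B): y => [|s t|c d]; rewrite ?(tensor_mul0l, tensor_mul0r) //.
  by rewrite !(tensor_mulDl, tensor_mulDr) => -> ->.
elim/(@tensor_ind k A B): z => [|s t|e f]; rewrite ?tensor_mul0r //.
  by rewrite !tensor_mulDr => -> ->.
by rewrite !tensor_mulE !mulrA.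
Qed.

Lemma tensor_mul1l : left_id (1 ⊗ 1) tensor_mul.
Proof.
elim/(@tensor_ind k A B) => [|s t|a b]; rewrite ?tensor_mul0r //.
  by rewrite tensor_mulDr => -> ->.
by rewrite tensor_mulE !mul1r.
Qed.

Lemma tensor_mul1r : right_id (1 ⊗ 1) tensor_mul.
Proof.
elim/(@tensor_ind k A B) => [|s t|a b]; rewrite ?tensor_mul0l //.
  by rewrite tensor_mulDl => -> ->.
by rewrite tensor_mulE !mulr1.
Qed.

(* 1 ⊗ 1 != 0 is not needed, so this stops at pzRingType. *)
HB.instance Definition _ := GRing.Zmodule_isPzRing.Build (tensor A B)
  tensor_mulA tensor_mul1l tensor_mul1r tensor_mulDl tensor_mulDr.

Lemma tpureM (a c : A) (b d : B) :
  (a ⊗ b : A ⊗ B) * (c ⊗ d) = (a * c) ⊗ (b * d).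
Proof. exact: tensor_mulE. Qed.

End TensorAlgebra.

HB.mixin Record Lmodule_isCoalgebra (k : fieldType) C of GRing.Lmodule k C := {
  comul : {linear C -> (C ⊗ C)%type};
  counit : {scalar C};
  coassoc : forall a,
    tassoc (tmap comul idfun (comul a)) = tmap idfun comul (comul a);
  counitl : forall a, tlift (fun a1 a2 => counit a1 *: a2) (comul a) = a;
  counitr : forall a, tlift (fun a1 a2 => counit a2 *: a1) (comul a) = a;
}.

#[short(type="coalgType")]
HB.structure Definition Coalgebra (k : fieldType) :=
  {C of GRing.Lmodule k C & Lmodule_isCoalgebra k C}.

(* Sweedler notation: if comul a = sum_i x_i ⊗ y_i then
   \sw_(a1, a2 <- a) F a1 a2 = sum_i F x_i y_i, for F bilinear. *)
Notation "\sw_ ( a1 , a2 <- a ) F" :=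
  (tlift (fun a1 a2 => F) (comul a)) : ring_scope.

HB.mixin Record Algebra_Coalgebra_isBialgebra (k : fieldType) A
    of GRing.Algebra k A & Coalgebra k A := {
  comul_monoid_morphism : monoid_morphism (comul : A -> A ⊗ A);
  counit_monoid_morphism : monoid_morphism (counit : A -> k);
}.

#[short(type="bialgType")]
HB.structure Definition Bialgebra (k : fieldType) :=
  {A of GRing.Algebra k A & Coalgebra k A & Algebra_Coalgebra_isBialgebra k A}.

HB.mixin Record Bialgebra_isHopf (k : fieldType) A of Bialgebra k A := {
  antipode : {linear A -> A};
  antipodel : forall a : A,
    \sw_(a1, a2 <- a) (antipode a1 * a2) = counit a *: 1;
  antipoder : forall a : A,
    \sw_(a1, a2 <- a) (a1 * antipode a2) = counit a *: 1;
}.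

#[short(type="hopfAlgType")]
HB.structure Definition HopfAlgebra (k : fieldType) :=
  {A of Bialgebra k A & Bialgebra_isHopf k A}.

Section Sweedler.
Context {k : fieldType}.

Lemma comul1 (A : bialgType k) : comul (1 : A) = 1 ⊗ 1.
Proof. exact: comul_monoid_morphism.1. Qed.

Lemma counit1 (A : bialgType k) : counit (1 : A) = 1.
Proof. exact: counit_monoid_morphism.1. Qed.

Lemma counitM (A : bialgType k) (a b : A) : counit (a * b) = counit a * counit b.
Proof. exact: counit_monoid_morphism.2. Qed.

Lemma sweedlerM (A : bialgType k) (W : lmodType k) (f : A -> A -> W) a b :
  bilin f ->
  \sw_(c1, c2 <- a * b) f c1 c2 =
  \sw_(a1, a2 <- a) \sw_(b1, b2 <- b) f (a1 * b1) (a2 * b2).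
Proof.
move=> bf; rewrite comul_monoid_morphism.2.
rewrite [X in tlift f X](_ : _ = \sw_(a1, a2 <- a) \sw_(b1, b2 <- b)
  ((a1 * b1) ⊗ (a2 * b2))) //.
rewrite lin_tlift; last exact: tlift_linear.
apply: eq_tlift => a1 a2; rewrite lin_tlift; last exact: tlift_linear.
by apply: eq_tlift => b1 b2; rewrite tliftE.
Qed.

Lemma sweedlerA (C : coalgType k) (W : lmodType k) (f : C -> C -> C -> W) a :
  (forall u, bilin (f u)) -> (forall v w, lin (fun u => f u v w)) ->
  \sw_(a1, a2 <- a) \sw_(b1, b2 <- a1) f b1 b2 a2 =
  \sw_(a1, a2 <- a) \sw_(b1, b2 <- a2) f a1 b1 b2.
Proof.
move=> f23 f1; pose g := tlift (fun u t => tlift (f u) t).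
have bg : bilin (fun u t => tlift (f u) t).
  apply: bilinP => [t|u]; first by apply: lin_tlift_fun => v w; exact: f1.
  exact: tlift_linear (f23 u).
have lg : lin g by exact: tlift_linear bg.
have la : bilin (fun t w => tlift (fun u v => u ⊗ (v ⊗ w)) t :> C ⊗ (C ⊗ C)).
  by blin.
pose h (t : (C ⊗ C) ⊗ C) := g (tassoc t).
have lh : lin h by move=> c x y; rewrite /h /tassoc (tlift_linear la) lg.
have gE u v w : g (u ⊗ (v ⊗ w)) = f u v w by rewrite /g tliftE // tliftE.
have := congr1 g (coassoc a); rewrite -[LHS]/(h _) /tmap.
rewrite (lin_tlift _ _ lh) (lin_tlift _ _ lg) => fE.
transitivity (tlift (fun u v => h (comul u ⊗ v)) (comul a)).
  apply: eq_tlift => a1 a2; rewrite /h /tassoc tliftE // (lin_tlift _ _ lg).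
  by apply: eq_tlift => b1 b2; rewrite gE.
by rewrite fE; apply: eq_tlift => a1 a2; rewrite /g tliftE.
Qed.

End Sweedler.

Section Actions.
Context {k : fieldType}.

Record coalgebra_hom (C D : coalgType k) (f : {linear C -> D}) : Prop := {
  coalgebra_hom_counit : forall a, counit (f a) = counit a;
  coalgebra_hom_comul : forall a, comul (f a) = tmap f f (comul a);
}.

Record module_algebra (H : bialgType k) (K : algType k) := ModuleAlgebra {
  act :> H -> K -> K;
  act_bilinear : bilin act;
  act1l : forall x, act 1 x = x;
  actMl : forall a b x, act (a * b) x = act a (act b x);
  act1r : forall a, act a 1 = counit a *: 1;
  actMr : forall a x y,
    act a (x * y) = \sw_(a1, a2 <- a) (act a1 x * act a2 y);
}.

Record module_bialgebra (H K : bialgType k) := ModuleBialgebra {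
  mb_module_algebra :> module_algebra H K;
  act_counit : forall a x,
    counit (mb_module_algebra a x) = counit a * counit x;
  act_comul : forall a x,
    comul (mb_module_algebra a x) =
    \sw_(a1, a2 <- a) \sw_(x1, x2 <- x)
      (mb_module_algebra a1 x1 ⊗ mb_module_algebra a2 x2);
}.

End Actions.

(* x ⊗ a plays the role of x # a; A only selects the multiplication. *)
Definition smash (k : fieldType) (H : bialgType k) (K : algType k)
  (A : module_algebra H K) : Type := K ⊗ H.

Section Smash.
Context {k : fieldType} {H : bialgType k} {K : algType k}.
Variable A : module_algebra H K.

Local Notation smash := (smash A).

HB.instance Definition _ := GRing.Lmodule.copy smash (tensor K H).


Definition smash_one : smash := 1 ⊗ 1.

Definition smash_mul (s t : smash) : smash :=
  tlift (fun x a => tlift (fun y b =>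
    \sw_(a1, a2 <- a) ((x * A a1 y) ⊗ (a2 * b))) t) s.

Let lin_actl (X : lmodType k) (g : X -> H) x : lin g -> lin (fun y => A (g y) x).
Proof. exact: bilin_linl (act_bilinear A). Qed.

Let lin_actr (X : lmodType k) (g : X -> K) a : lin g -> lin (fun y => A a (g y)).
Proof. exact: bilin_linr (act_bilinear A). Qed.

Ltac abl :=
  do ! match goal with
  | |- lin (fun x => act _ _ _) => first [apply: lin_actl | apply: lin_actr]
  | |- lin (act _ _) => exact: (lin_actr _ (@lin_id _ _))
  | |- _ => lin_step
  end.

Lemma smash_mul_bilinear : bilin smash_mul.
Proof. rewrite /smash_mul; abl. Qed.

Lemma smash_mulE x a y b : smash_mul (x ⊗ a) (y ⊗ b) =
  \sw_(a1, a2 <- a) ((x * A a1 y) ⊗ (a2 * b)).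
Proof. by rewrite /smash_mul tliftE; [rewrite tliftE //; abl | abl]. Qed.

Lemma smash_mulDl : left_distributive smash_mul +%R.
Proof. by move=> x y z; rewrite (linD (smash_mul_bilinear.1 z)). Qed.

Lemma smash_mulDr : right_distributive smash_mul +%R.
Proof. by move=> x y z; rewrite (linD (smash_mul_bilinear.2 x)). Qed.

Lemma smash_mul0l : left_zero 0 smash_mul.
Proof. by move=> x; rewrite (lin0 (smash_mul_bilinear.1 x)). Qed.

Lemma smash_mul0r : right_zero 0 smash_mul.
Proof. by move=> x; rewrite (lin0 (smash_mul_bilinear.2 x)). Qed.

Lemma smash_mulA : associative smash_mul.
Proof.
move=> x y z; elim/(@tensor_ind k K H): x => [|s t|x a]; rewrite ?smash_mul0l //.
  by rewrite !smash_mulDl => -> ->.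
elim/(@tensor_ind k K H): y => [|s t|y b]; rewrite ?(smash_mul0l, smash_mul0r) //.
  by rewrite !(smash_mulDl, smash_mulDr) => -> ->.
elim/(@tensor_ind k K H): z => [|s t|z c]; rewrite ?smash_mul0r //.
  by rewrite !smash_mulDr => -> ->.
rewrite !smash_mulE.
transitivity (\sw_(b1, b2 <- b) \sw_(a1, a2 <- a) \sw_(e1, e2 <- a1)
    ((x * (A e1 y * A e2 (A b1 z))) ⊗ (a2 * (b2 * c)) : K ⊗ H)).
  rewrite (lin_tlift _ _ (smash_mul_bilinear.2 _)); apply: eq_tlift => b1 b2.
  rewrite smash_mulE; apply: eq_tlift => a1 a2; rewrite actMr.
  rewrite (lin_tlift _ _ (_ : lin (fun w => (x * w) ⊗ (a2 * (b2 * c))))) //; abl.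
transitivity (\sw_(a1, a2 <- a) \sw_(e1, e2 <- a2) \sw_(b1, b2 <- b)
    ((x * (A a1 y * A e1 (A b1 z))) ⊗ (e2 * (b2 * c)) : K ⊗ H)).
  rewrite exchange_tlift.
  under eq_tlift => a1 a2 do rewrite exchange_tlift.
  pose F (u v w : H) := \sw_(b1, b2 <- b)
    ((x * (A u y * A v (A b1 z))) ⊗ (w * (b2 * c)) : K ⊗ H).
  by apply: (@sweedlerA _ _ _ F); rewrite /F; abl.
rewrite (lin_tlift _ _ (smash_mul_bilinear.1 _)); apply: eq_tlift => a1 a2.
rewrite smash_mulE.
rewrite (@sweedlerM _ _ _
  (fun u v => ((x * A a1 y) * A u z) ⊗ (v * c) : K ⊗ H)); last by abl.
by apply: eq_tlift => e1 e2; apply: eq_tlift => b1 b2; rewrite actMl !mulrA.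
Qed.

Lemma smash_mul1l : left_id smash_one smash_mul.
Proof.
elim/(@tensor_ind k K H) => [|s t|y b]; rewrite ?smash_mul0r //.
  by rewrite smash_mulDr => -> ->.
rewrite smash_mulE comul1 tliftE; last by abl.
by rewrite act1l !mul1r.
Qed.

Lemma smash_mul1r : right_id smash_one smash_mul.
Proof.
elim/(@tensor_ind k K H) => [|s t|x a]; rewrite ?smash_mul0l //.
  by rewrite smash_mulDl => -> ->.
rewrite smash_mulE -[in RHS](counitl a).
rewrite (lin_tlift _ _ (_ : lin (fun w => x ⊗ w))); last by abl.
apply: eq_tlift => a1 a2; rewrite act1r mulr1 -scalerAr mulr1.
by rewrite (linZ ((@tpure_bilinear k K H).1 a2)) (linZ ((@tpure_bilinear k K H).2 x)).
Qed.

Lemma smash_one_neq0 : smash_one != 0.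
Proof.
pose f := tlift (fun (x : K) (a : H) => counit a *: x).
have bf : bilin (fun (x : K) (a : H) => counit a *: x) by abl.
apply/eqP => /(congr1 f); rewrite /f tliftE // counit1 scale1r.
by rewrite (lin0 (tlift_linear bf)) => /eqP; rewrite oner_eq0.
Qed.

HB.instance Definition _ := GRing.Zmodule_isNzRing.Build smash
  smash_mulA smash_mul1l smash_mul1r smash_mulDl smash_mulDr smash_one_neq0.

Lemma smash_scalerAl c (s t : smash) : c *: (s * t) = (c *: s) * t.
Proof. by rewrite -[RHS]/(smash_mul _ _) (linZ (smash_mul_bilinear.1 t)). Qed.

Lemma smash_scalerAr c (s t : smash) : c *: (s * t) = s * (c *: t).
Proof. by rewrite -[RHS]/(smash_mul _ _) (linZ (smash_mul_bilinear.2 s)). Qed.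

HB.instance Definition _ := GRing.Lmodule_isLalgebra.Build k smash smash_scalerAl.
HB.instance Definition _ := GRing.Lalgebra_isAlgebra.Build k smash smash_scalerAr.

Lemma smashM (x y : K) (a b : H) :
  (x ⊗ a : smash) * (y ⊗ b) = \sw_(a1, a2 <- a) ((x * A a1 y) ⊗ (a2 * b)).
Proof. exact: smash_mulE. Qed.

Lemma smash1E : (1 : smash) = 1 ⊗ 1.
Proof. by []. Qed.

End Smash.

Definition subalgebra (k : fieldType) (A : algType k) (S : set A) : Prop :=
  GRing.subalg_closed (mem S).

Section CrossedHom.
Context {k : fieldType} {H K : hopfAlgType k}.
Variable A : module_bialgebra H K.

Record crossed_hom (f : {linear H -> K}) : Prop := {
  crossed_hom_coalgebra_hom : coalgebra_hom f;
  crossed_homM : forall a b, f (a * b) = \sw_(a1, a2 <- a) (f a1 * A a2 (f b));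
}.

Definition graph (f : {linear H -> K}) : set (smash A) :=
  range (fun a => \sw_(a1, a2 <- a) (f a1 ⊗ a2)).

End CrossedHom.

Arguments graph {k H K} A f.

(* Main.v *)
Require Import Defs.
From mathcomp Require Import all_boot all_order all_algebra.
From mathcomp Require Import boolp classical_sets.

(** Write [graph_map f a] for the element [f a_1 # a_2] of the smash product, so
    that the graph is the image of the linear map [graph_map f].

    The counits give two projections of [K # H]: [smash_projK], [x # a |-> ε(a) x],
    and [smash_projH], [x # a |-> ε(x) a].  The first recovers [f a] from
    [graph_map f a], and the second recovers [a], because [f] preserves the
    counit.  The second is moreover multiplicative, because the action preserves
    the counit of [K] ([smash_projHM]).  Hence if the product of [graph_map f a]
    and [graph_map f b] lies in the graph at all, it is [graph_map f c] with
    [c = a b]; the image of this equation under [smash_projK] is the crossed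
    homomorphism identity, by [smash_projK_graphM].

    Conversely, that identity together with coassociativity makes [graph_map f]
    multiplicative ([graph_mapM]).  The graph contains the unit because [f 1] is
    both idempotent and grouplike; grouplike elements of a Hopf algebra are
    invertible, so [f 1 = 1] ([crossed_hom1]). *)

Section Graph.
Import GRing.Theory.
Local Open Scope ring_scope.

(** The antipode of a grouplike element is its inverse, and the only invertible
    idempotent is the unit. *)
Lemma grouplike_idempotent_eq1 {k : fieldType} {K : hopfAlgType k} (g : K) :
  comul g = g ⊗ g -> counit g = 1 -> g * g = g -> g = 1.
Proof.
move=> comul_g counit_g gg.
have Sg : antipode g * g = 1.
  have := antipodel g; rewrite comul_g counit_g scale1r tliftE //; blin.
by rewrite -[g]mul1r -Sg -mulrA gg.
Qed.

Context {k : fieldType} {H K : hopfAlgType k}.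
Variable A : module_bialgebra H K.

Let lin_actl (X : lmodType k) (g : X -> H) x :
  lin g -> lin (fun y => A (g y) x).
Proof. exact: bilin_linl _ (act_bilinear A). Qed.

Let lin_actr (X : lmodType k) (g : X -> K) a :
  lin g -> lin (fun y => A a (g y)).
Proof. exact: bilin_linr _ (act_bilinear A). Qed.

Ltac abl :=
  do ! match goal with
  | |- lin (fun x => act _ _ _) => first [apply: lin_actl | apply: lin_actr]
  | |- lin (act _ _) => exact: (lin_actr _ (@lin_id _ _))
  | |- _ => lin_step
  end.

Definition smash_projK (s : smash A) : K :=
  tlift (fun x (a : H) => counit a *: x) s.

Definition smash_projH (s : smash A) : H :=
  tlift (fun (x : K) a => counit x *: a) s.

Lemma smash_projK_linear : lin smash_projK.
Proof. by apply: tlift_linear; abl. Qed.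

Lemma smash_projH_linear : lin smash_projH.
Proof. by apply: tlift_linear; abl. Qed.

Lemma smash_projKE (x : K) (a : H) : smash_projK (x ⊗ a) = counit a *: x.
Proof. by rewrite /smash_projK tliftE //; abl. Qed.

Lemma smash_projHE (x : K) (a : H) : smash_projH (x ⊗ a) = counit x *: a.
Proof. by rewrite /smash_projH tliftE //; abl. Qed.

(** The action preserves counits, so the factor [a_1] acting on [y] is absorbed
    by the counit law. *)
Lemma smash_projHM (s t : smash A) :
  smash_projH (s * t) = smash_projH s * smash_projH t.
Proof.
have projH0 := lin0 smash_projH_linear; have projHD := linD smash_projH_linear.
elim/(@tensor_ind k K H): s => [|s s'|x a].
- by rewrite mul0r projH0 mul0r.
- by move=> IHs IHs'; rewrite mulrDl !projHD mulrDl IHs IHs'.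
elim/(@tensor_ind k K H): t => [|t t'|y b].
- by rewrite mulr0 projH0 mulr0.
- by move=> IHt IHt'; rewrite mulrDr !projHD mulrDr IHt IHt'.
rewrite smashM (lin_tlift _ _ smash_projH_linear) !smash_projHE.
rewrite -[in RHS](counitl a) -scalerAl -scalerAr scalerA.
have lg : lin (fun c : H => (counit x * counit y) *: (c * b)) by abl.
rewrite (lin_tlift _ _ lg); apply: eq_tlift => a1 a2.
rewrite smash_projHE counitM act_counit -scalerAl scalerA.
by rewrite mulrAC -mulrA [counit a1 * _]mulrC mulrA mulrAC.
Qed.

(** [K] is a left module over [K # H], with [x # a] acting by
    [z |-> x (a ⇀ z)], and [smash_projK] is the module map [s |-> s · 1]. *)
Lemma smash_projK_pureM (x : K) (a : H) (t : smash A) :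
  smash_projK ((x ⊗ a : smash A) * t) = x * A a (smash_projK t).
Proof.
have projK0 := lin0 smash_projK_linear; have projKD := linD smash_projK_linear.
have act_lin := (act_bilinear A).2 a.
elim/(@tensor_ind k K H): t => [|t t'|y b].
- by rewrite mulr0 projK0 (lin0 act_lin) mulr0.
- by move=> IHt IHt'; rewrite mulrDr !projKD IHt IHt' (linD act_lin) mulrDr.
rewrite smashM (lin_tlift _ _ smash_projK_linear) smash_projKE (linZ act_lin).
rewrite -[in RHS](counitr a).
have lg : lin (fun c : H => x * (counit b *: A c y)) by abl.
rewrite (lin_tlift _ _ lg); apply: eq_tlift => a1 a2.
rewrite smash_projKE counitM (linZ ((act_bilinear A).1 y)) scalerA mulrC.
by rewrite -scalerAr.
Qed.

Definition graph_map (f : {linear H -> K}) (a : H) : smash A :=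
  \sw_(a1, a2 <- a) (f a1 ⊗ a2).

Variable f : {linear H -> K}.

Lemma graph_map_linear : lin (graph_map f).
Proof. by rewrite /graph_map; abl. Qed.

Lemma smash_projK_graph a : smash_projK (graph_map f a) = f a.
Proof.
rewrite (lin_tlift _ _ smash_projK_linear) -[in RHS](counitr a).
have lf : lin f by abl.
rewrite (lin_tlift _ _ lf).
by apply: eq_tlift => a1 a2; rewrite smash_projKE linearZ.
Qed.

Lemma smash_projH_graph a : coalgebra_hom f -> smash_projH (graph_map f a) = a.
Proof.
move=> coalg_f; rewrite (lin_tlift _ _ smash_projH_linear) -[in RHS](counitl a).
apply: eq_tlift => a1 a2.
by rewrite smash_projHE (coalgebra_hom_counit coalg_f).
Qed.

Lemma smash_projK_graphM a b :
  smash_projK (graph_map f a * graph_map f b) =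
  \sw_(a1, a2 <- a) (f a1 * A a2 (f b)).
Proof.
have lg : lin (fun s : smash A => smash_projK (s * graph_map f b)).
  by move=> c s t; rewrite mulrDl -scalerAl smash_projK_linear.
rewrite (lin_tlift _ _ lg); apply: eq_tlift => a1 a2.
by rewrite smash_projK_pureM smash_projK_graph.
Qed.

Lemma crossed_hom1 : crossed_hom A f -> f 1 = 1.
Proof.
case=> -[counit_f comul_f] fM; apply: grouplike_idempotent_eq1.
- by rewrite comul_f comul1 /tmap tliftE //; abl.
- by rewrite counit_f counit1.
have := fM 1 1; rewrite mulr1 comul1 tliftE ?act1l; last by abl.
by move=> <-.
Qed.

(** Both sides equal [f(a_1)(a_2 ⇀ f(b_1)) # a_3 b_2]. *)
Lemma graph_mapM a b :
  crossed_hom A f -> graph_map f (a * b) = graph_map f a * graph_map f b.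
Proof.
case=> _ fM.
pose F (b1 b2 u v w : H) : K ⊗ H := (f u * A v (f b1)) ⊗ (w * b2).
transitivity (\sw_(b1, b2 <- b) \sw_(a1, a2 <- a) \sw_(c1, c2 <- a1)
    F b1 b2 c1 c2 a2).
  rewrite /graph_map sweedlerM; last by abl.
  rewrite exchange_tlift; apply: eq_tlift => b1 b2; apply: eq_tlift => a1 a2.
  have lg : lin (fun x : K => (x ⊗ (a2 * b2) : K ⊗ H)) by abl.
  by rewrite fM (lin_tlift _ _ lg).
have lMr : lin (fun t : smash A => graph_map f a * t).
  by move=> c s t; rewrite mulrDr -scalerAr.
rewrite [in RHS]/graph_map (lin_tlift _ _ lMr); apply: eq_tlift => b1 b2.
have lMl : lin (fun s : smash A => s * (f b1 ⊗ b2 : smash A)).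
  by move=> c s t; rewrite mulrDl -scalerAl.
rewrite (lin_tlift _ _ lMl) sweedlerA; [| by rewrite /F; abl ..].
by apply: eq_tlift => a1 a2; rewrite smashM.
Qed.

End Graph.

Theorem theorem3p2 (k : fieldType) (chark0 : [pchar k]%R =i pred0)
    (H K : hopfAlgType k) (A : module_bialgebra H K) (f : {linear H -> K}%R)
    (coalg_f : coalgebra_hom f) :
  crossed_hom A f <-> subalgebra (graph A f).
Proof.
split=> [crossed_f | [_ _ graphM]].
  split=> [|c s t|s t]; rewrite !inE.
  - exists 1%R => //; rewrite comul1 tliftE ?(crossed_hom1 _ _ crossed_f) //.
    by blin.
  - move=> [a _ <-] [b _ <-]; exists (c *: a + b)%R => //.
    exact: graph_map_linear.
  - move=> [a _ <-] [b _ <-]; exists (a * b)%R => //.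
    exact: graph_mapM.
split=> // a b.
have graph_in d : graph_map A f d \in mem (graph A f) by rewrite inE; exists d.
have := graphM _ _ (graph_in a) (graph_in b); rewrite inE => -[c _ graph_c].
(* The multiplicative projection to H identifies the preimage of the product. *)
have c_eq : c = (a * b)%R.
  rewrite -(smash_projH_graph A f c coalg_f) /graph_map graph_c smash_projHM.
  by rewrite !smash_projH_graph.
rewrite -smash_projK_graphM -graph_c c_eq.
by rewrite -[RHS]/(smash_projK A (graph_map A f _)) smash_projK_graph.
Qed.
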